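(* (Strong maximum principle.) Let $G=(V,E)$ be a finite connected weighted graph, let $T>0$, and let $k:V\times[0,T]\to\mathbb{R}$ be bounded. Suppose $u\in C^1(V\times[0,T])$ satisfies $$u_t-\Delta_V u+k(x,t)u\ge 0\ \text{ for }(x,t)\in V\times(0,T],\qquad u(x,0)=u_0(x)\ \text{ for }x\in V,$$ where $u_0\ge 0$ and $u_0\not\equiv 0$ on $V$. Then $u(x,t)>0$ for all $x\in V$ and $t\in(0,T]$.
   Context: $G=(V,E)$ is a finite, undirected, connected graph with a weight $\omega:V\times V\to[0,\infty)$, $\omega_{xy}=\omega_{yx}$, $\omega_{xy}=0$ if and only if $xy\notin E$, and a measure $\mu:V\to(0,\infty)$. The graph Laplacian is $\Delta_V u(x)=\sum_{y\in V}(u(y)-u(x))\frac{\omega_{yx}}{\mu(x)}$ (acting in $x$). For an interval $I$, $u\in C^1(V\times I)$ means that $u(x,\cdot)$ is continuously differentiable on $I$ for each $x\in V$ (one-sided at included endpoints). *)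

(* Defs.v *)
From mathcomp Require Import all_boot all_order all_algebra.
From mathcomp Require Import all_classical all_reals all_analysis.
Set Implicit Arguments.
Unset Strict Implicit.
Unset Printing Implicit Defensive.
Import Order.TTheory GRing.Theory Num.Theory.
Import numFieldNormedType.Exports.
Local Open Scope classical_set_scope.
Local Open Scope ring_scope.

Record weighted_graph (R : realType) (V : finType) := WeightedGraph {
  edge : rel V;
  weight : V -> V -> R;
  vmeasure : V -> R;
  edge_sym : symmetric edge;
  edge_connected : forall x y : V, connect edge x y;
  weight_ge0 : forall x y : V, 0 <= weight x y;
  weight_sym : forall x y : V, weight x y = weight y x;
  weight_eq0 : forall x y : V, weight x y = 0 <-> ~~ edge x y;
  vmeasure_gt0 : forall x : V, 0 < vmeasure x
}.

Definition laplacian (R : realType) (V : finType) (G : weighted_graph R V)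
    (u : V -> R) (x : V) : R :=
  \sum_(y : V) (u y - u x) * (weight G y x / vmeasure G x).

(* A function on V x I is represented by a total function V -> R -> R whose
   values outside I are irrelevant.  Derivatives are therefore taken relative
   to I: only difference quotients with both points in I are used, which gives
   the usual derivative in the interior of an interval I and the one-sided
   derivative at an endpoint belonging to I. *)
Definition derivable_within (R : realType) (I : set R) (f : R -> R) (t : R)
    : Prop :=
  cvg ((f s - f t) / (s - t) @[s --> within I t^']).

Definition derive_within (R : realType) (I : set R) (f : R -> R) (t : R) : R :=
  lim ((f s - f t) / (s - t) @[s --> within I t^']).

Definition C1_within (R : realType) (I : set R) (f : R -> R) : Prop :=
  (forall t, I t -> derivable_within I f t) /\
  {within I, continuous (derive_within I f)}.

(* Main.v *)
Require Import Defs.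
From mathcomp Require Import all_boot all_order all_algebra.
From mathcomp Require Import all_classical all_reals all_analysis.
From mathcomp Require Import ring lra.
Set Implicit Arguments.
Unset Strict Implicit.
Unset Printing Implicit Defensive.
Import Order.TTheory GRing.Theory Num.Theory.
Import numFieldNormedType.Exports.
Local Open Scope classical_set_scope.
Local Open Scope ring_scope.

(** The argument runs on derivatives from the left: they exist at every
time in ]0, T], the final time included, and a function whose minimum over the
past and present is attained at the present time has a nonpositive one.

Nonnegativity. Suppose u has a negative value. Multiplying u by exp(c t) with
c very negative does not change signs, so the product has a negative minimum
over V x [0, T], at some (y, m) with m > 0. At time m the vertex y also
minimises u over V, hence the Laplacian of u there is nonnegative and
u_t >= - k u >= M u for a bound M of |k|; if c < - M, the product has a positive
left derivative at m, which contradicts minimality. This is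
[min_principle], where the spatial operator only enters through its sign at a
negative spatial minimum.

Persistence of positivity. Once u >= 0, dropping the nonnegative inflow from
the neighbours leaves u_t >= - (D + M) u at each vertex separately, D being its
weighted degree. Hence a vertex that is positive at time 0 stays positive
([gt0_of_left_derivative_ge]).

Propagation of zeros. If u(y, t) = 0, time t is a minimum of u(y, .), so the
left derivative there is nonpositive and the inflow at (y, t), a sum of
nonnegative terms, must vanish: u is zero at time t at every neighbour of y.
By connectedness one zero at time t makes u vanish on all of V at time t, so
by persistence u_0 has no positive value. *)

(** * Left derivatives *)

Definition left_derivative (R : realType) (f : R -> R) (t l : R) : Prop :=
  (f s - f t) / (s - t) @[s --> t^'-] --> l.

Lemma left_derivative_of_within (R : realType) (T : R) (f : R -> R) (t : R) :
  0 < t <= T -> derivable_within `[0, T] f t ->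
  left_derivative f t (derive_within `[0, T] f t).
Proof.
move=> /andP[t0 tT] df; apply: cvg_trans df.
apply: cvg_app => A; rewrite /= /within /= => dA.
have t_gt0 : \forall s \near t^'-, 0 < s by exact: nbhs_left_gt.
have dA' : \forall s \near t^'-, s != t -> s \in `[0, T] -> A s.
  exact: (@cvg_within _ (nbhs t) _ (fun s => s < t) _ dA).
near=> s.
have st : s < t by near: s; exact: nbhs_left_lt.
have s0 : 0 < s by near: s.
have sA : s != t -> s \in `[0, T] -> A s by near: s.
by apply: sA; rewrite ?lt_eqF // in_itv /= (ltW s0) (le_trans (ltW st)).
Unshelve. all: by end_near. Qed.

(** The difference quotient has a limit, so multiplying it by s - t gives a
quantity that tends to 0; the case s = t, which the quotient misses, is
trivial. *)
Lemma continuous_of_derivable_within (R : realType) (I : set R) (f : R -> R) :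
  (forall t, I t -> derivable_within I f t) -> {within I, continuous f}.
Proof.
move=> df; apply/subspace_continuousP => t It.
have /cvg_ex[l dl] := df t It.
have cv : (f s - f t) / (s - t) * (s - t) + f t @[s --> within I t^'] --> f t.
  rewrite -[X in _ --> X]add0r -[X in _ --> X + _](mulr0 l).
  apply: cvgD; last exact: cvg_cst.
  apply: cvgM => //.
  rewrite -(subrr t); apply: cvgB; last exact: cvg_cst.
  by apply: cvg_within_filter; apply: cvg_within_filter.
move=> A fA; have := cv A fA.
apply: (@filterS _ (nbhs t)) => s h Is.
have [->|st] := eqVneq s t; first exact: (nbhs_singleton fA).
by have := h st Is; rewrite /= /= divfK ?subrK // subr_eq0.
Qed.

Lemma left_derivative_at_min (R : realType) (f : R -> R) (t l : R) :
  0 < t -> left_derivative f t l ->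
  (forall s, 0 <= s < t -> f t <= f s) -> l <= 0.
Proof.
move=> t0 fl fmin; rewrite -(cvg_lim (@Rhausdorff R) fl).
apply: limr_le; first by apply/cvg_ex; exists l.
near=> s.
have st : s < t by near: s; exact: nbhs_left_lt.
have s0 : 0 < s by near: s; exact: nbhs_left_gt.
by rewrite mulr_ge0_le0 ?subr_ge0 ?fmin ?invr_le0 ?subr_le0 ?ltW // s0.
Unshelve. all: by end_near. Qed.

Lemma left_derivativeB (R : realType) (f g : R -> R) (t l m : R) :
  left_derivative f t l -> left_derivative g t m ->
  left_derivative (fun s => f s - g s) t (l - m).
Proof.
move=> fl gm; rewrite /left_derivative.
have -> : (fun s => (f s - g s - (f t - g t)) / (s - t)) =
    (fun s => (f s - f t) / (s - t) - (g s - g t) / (s - t)).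
  by apply/funext => s; ring.
exact: cvgB.
Qed.

Lemma left_derivativeM (R : realType) (f g : R -> R) (t l m : R) :
  {for t, continuous f} -> left_derivative f t l -> left_derivative g t m ->
  left_derivative (fun s => f s * g s) t (f t * m + l * g t).
Proof.
move=> cf fl gm; rewrite /left_derivative.
have -> : (fun s => (f s * g s - f t * g t) / (s - t)) =
    (fun s => f s * ((g s - g t) / (s - t)) + (f s - f t) / (s - t) * g t).
  by apply/funext => s; ring.
apply: cvgD; last by apply: cvgM => //; exact: cvg_cst.
by apply: cvgM => //; exact: cvg_at_left_filter.
Qed.

(** Caratheodory's form of differentiability is used because it already speaks
of the increment from t to s, whereas the usual limit is over increments h
tending to 0. *)
Lemma left_derivative_of_is_derive (R : realType) (f : R -> R) (t l : R) :
  is_derive t 1 f l -> left_derivative f t l.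
Proof.
move=> /is_derive1_caratheodory[g [gE cg <-]].
have /cvg_at_left_filter : g s @[s --> t] --> g t by exact: cg.
apply: cvg_trans; apply: near_eq_cvg; near=> s.
have st : s < t by near: s; exact: nbhs_left_lt.
by rewrite gE mulfK // subr_eq0 lt_eqF.
Unshelve. all: by end_near. Qed.

Lemma continuous_expRMl (R : realType) (c : R) :
  continuous (fun s : R => expR (c * s)).
Proof.
move=> t; apply: continuous_comp; last exact: continuous_expR.
exact: mulrl_continuous.
Qed.

Lemma left_derivative_expRMl (R : realType) (c t : R) :
  left_derivative (fun s => expR (c * s)) t (c * expR (c * t)).
Proof.
apply: left_derivative_of_is_derive.
apply: is_derive_eq.
by rewrite /GRing.scale /= mulr1 mulrC.
Qed.

(** * Minimum principles *)

(** The lower bound on the derivative is only required where a minimum of the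
whole family over the index set is attained and negative. This hides the
spatial operator, so the same lemma serves for the heat inequality on the
graph and, with a one-point index set, for scalar differential inequalities. *)
Lemma min_principle (R : realType) (V : finType) (T K : R)
    (u d : V -> R -> R) :
  (forall x, {within `[0, T], continuous (u x)}) ->
  (forall x t, 0 < t <= T -> left_derivative (u x) t (d x t)) ->
  (forall x t, 0 < t <= T -> u x t < 0 -> (forall y, u x t <= u y t) ->
     K * u x t <= d x t) ->
  (forall x, 0 <= u x 0) ->
  forall x t, 0 <= t <= T -> 0 <= u x t.
Proof.
move=> cu du hd u0 x t tI; rewrite leNgt; apply/negP => uxt_lt0.
have T0 : 0 <= T by case/andP: tI => /le_trans; apply.
(* Any exponent below - K makes the derivative of w positive at a negative
   minimum. *)
pose c := - (K + 1).
pose w y s := expR (c * s) * u y s.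
have cw y : {within `[0, T], continuous (w y)}.
  apply/subspace_continuousP => s sI; apply: cvgM.
    by apply: cvg_within_filter; exact: continuous_expRMl.
  by move/subspace_continuousP: (cu y); apply.
(* A global minimum of w is found as the least of the minima in time of the
   finitely many functions w y. *)
pose P y s := s \in `[0, T] /\ forall r, r \in `[0, T] -> w y s <= w y r.
have exP y : exists s, P y s.
  by have [s sI smin] := EVT_min T0 (cw y); exists s.
have [m mP] := choice exP.
case: (@arg_minP _ _ V x xpredT (fun y => w y (m y)) isT) => y _ ymin.
have [mI _] := mP y.
have wmin z s : s \in `[0, T] -> w y (m y) <= w z s.
  by move=> sI; apply: le_trans (ymin z isT) _; case: (mP z) => _; apply.
have w_lt0 : w y (m y) < 0.
  apply: le_lt_trans (wmin x t _) _; first by rewrite in_itv.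
  by rewrite pmulr_rlt0 ?expR_gt0.
move: mI; rewrite in_itv /= => mI.
have u_lt0 : u y (m y) < 0 by rewrite -(pmulr_rlt0 _ (expR_gt0 (c * m y))).
have m_gt0 : 0 < m y.
  rewrite lt_neqAle; case/andP: (mI) => -> _; rewrite andbT.
  by apply/eqP => m0; move: u_lt0; rewrite -m0 ltNge u0.
have mT : 0 < m y <= T by rewrite m_gt0; case/andP: mI.
have dw : left_derivative (w y) (m y)
    (expR (c * m y) * d y (m y) + c * expR (c * m y) * u y (m y)).
  apply: left_derivativeM; [exact: continuous_expRMl| |exact: du].
  exact: left_derivative_expRMl.
have dw_le0 := left_derivative_at_min m_gt0 dw.
have {dw_le0} : expR (c * m y) * (d y (m y) + c * u y (m y)) <= 0.
  rewrite mulrDr mulrCA mulrA; apply: dw_le0 => s /andP[s0 sm].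
  by apply: wmin; rewrite in_itv /= s0 (le_trans (ltW sm)) //; case/andP: mI.
rewrite pmulr_rle0 ?expR_gt0 //.
move=> h2.
have K_le : K * u y (m y) <= d y (m y).
  apply: hd => // z; rewrite -(ler_pM2l (expR_gt0 (c * m y))).
  by apply: wmin; rewrite in_itv.
by move: h2; rewrite /c => h2; lra.
Qed.

(** Comparison with the solution f(0) exp(- K t) of the equality case: the
difference starts at 0 and satisfies the same inequality, so the minimum
principle on one point shows that it is nonnegative. *)
Lemma gt0_of_left_derivative_ge (R : realType) (T K : R) (f d : R -> R) :
  {within `[0, T], continuous f} ->
  (forall t, 0 < t <= T -> left_derivative f t (d t)) ->
  (forall t, 0 < t <= T -> - K * f t <= d t) ->
  0 < f 0 -> forall t, 0 <= t <= T -> 0 < f t.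
Proof.
move=> cf df hd f0 t tI.
pose h (_ : unit) s := f s - expR (- K * s) * f 0.
pose h' (_ : unit) s :=
  d s - (expR (- K * s) * 0 + - K * expR (- K * s) * f 0).
suff: 0 <= h tt t.
  rewrite subr_ge0; apply: lt_le_trans.
  by rewrite mulr_gt0 // expR_gt0.
apply: (@min_principle R unit T (- K) h h') => //.
- case; apply/subspace_continuousP => s sI; apply: cvgB.
    by move/subspace_continuousP: cf; apply.
  apply: cvgM; last exact: cvg_cst.
  by apply: cvg_within_filter; exact: continuous_expRMl.
- case=> s sI; apply: left_derivativeB; first exact: df.
  apply: (@left_derivativeM R (fun s => expR (- K * s)) (fun=> f 0)).
  + exact: continuous_expRMl.
  + exact: left_derivative_expRMl.
  + by apply: left_derivative_of_is_derive; exact: is_derive_cst.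
- case=> s sI _ _; rewrite /h /h' mulr0 add0r mulrBr mulrA.
  by rewrite lerB // hd.
- by case; rewrite /h mulr0 expR0 mul1r subrr.
Qed.

(** * Strong maximum principle *)

Theorem theorem3p7 (R : realType) (V : finType) (G : weighted_graph R V)
    (T : R) (hT : 0 < T)
    (k : V -> R -> R)
    (hk : exists M : R, forall (x : V) (t : R), 0 <= t <= T -> `|k x t| <= M)
    (u : V -> R -> R) (hu : forall x : V, C1_within `[0, T] (u x))
    (u0 : V -> R)
    (hpde : forall (x : V) (t : R), 0 < t <= T ->
      derive_within `[0, T] (u x) t - laplacian G (fun y => u y t) x
        + k x t * u x t >= 0)
    (hinit : forall x : V, u x 0 = u0 x)
    (hu0_ge0 : forall x : V, 0 <= u0 x)
    (hu0_neq0 : exists x : V, u0 x != 0) :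
  forall (x : V) (t : R), 0 < t <= T -> 0 < u x t.
Proof.
have [M kM] := hk.
pose d x := derive_within `[0, T] (u x).
have cu x : {within `[0, T], continuous (u x)}.
  by apply: continuous_of_derivable_within; case: (hu x).
have du x t : 0 < t <= T -> left_derivative (u x) t (d x t).
  move=> tI; apply: left_derivative_of_within => //; case: (hu x) => + _.
  by apply; rewrite /= in_itv /=; case/andP: tI => /ltW -> ->.
have kM' x t : 0 < t <= T -> - M <= k x t <= M.
  by move=> /andP[t0 tT]; rewrite -ler_norml kM // ltW.
pose a y x := weight G y x / vmeasure G x.
have a_ge0 y x : 0 <= a y x.
  by rewrite divr_ge0 ?weight_ge0 // ltW // vmeasure_gt0.
have u_ge0 : forall x t, 0 <= t <= T -> 0 <= u x t.
  apply: (@min_principle R V T M u d) => //.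
  - move=> x t tI u_lt0 umin.
    have lap_ge0 : 0 <= laplacian G (fun y => u y t) x.
      by apply: sumr_ge0 => y _; rewrite mulr_ge0 ?a_ge0 // subr_ge0.
    have ku : M * u x t <= - k x t * u x t.
      by rewrite ler_nM2r //; case/andP: (kM' x t tI) => *; lra.
    by have := hpde x t tI; rewrite -/(d x t); lra.
  - by move=> x; rewrite hinit.
(* Splitting the Laplacian into inflow and outflow isolates the part of the
   inequality that involves u at x alone. *)
pose D x := \sum_y a y x.
have lapE x t : laplacian G (fun y => u y t) x =
    \sum_y u y t * a y x - D x * u x t.
  rewrite /laplacian /D mulr_suml -sumrB; apply: eq_bigr => y _.
  by rewrite mulrBl [X in _ - X]mulrC.
have inflow_ge0 x t : 0 <= t <= T -> 0 <= \sum_y u y t * a y x.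
  by move=> tI; apply: sumr_ge0 => y _; rewrite mulr_ge0 ?u_ge0.
have u_gt0 x : 0 < u x 0 -> forall t, 0 <= t <= T -> 0 < u x t.
  apply: (@gt0_of_left_derivative_ge R T (D x + M) (u x) (d x)) => //.
  - exact: du.
  - move=> t tI.
    have tI' : 0 <= t <= T by case/andP: tI => /ltW -> ->.
    have ku : k x t * u x t <= M * u x t.
      by rewrite ler_wpM2r ?u_ge0 //; case/andP: (kM' x t tI).
    have := hpde x t tI; rewrite -/(d x t) lapE.
    have := inflow_ge0 x t tI'; lra.
move=> x t tI.
have tI' : 0 <= t <= T by case/andP: tI => /ltW -> ->.
rewrite lt0r u_ge0 // andbT; apply/eqP => uxt0.
(* A zero at time t spreads along edges. *)
have step : forall y z, edge G y z -> u y t = 0 -> u z t = 0.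
  move=> y z yz uy0.
  have d_le0 : d y t <= 0.
    case/andP: (tI) => t0 tT.
    apply: (left_derivative_at_min t0 (du y t tI)) => s /andP[s0 st].
    by rewrite uy0 u_ge0 // s0 (le_trans (ltW st)).
  have sum0 : \sum_w u w t * a w y = 0.
    apply/eqP; rewrite eq_le inflow_ge0 // andbT.
    have := hpde y t tI; rewrite -/(d y t) lapE uy0; lra.
  have /eqP := sum0.
  rewrite psumr_eq0 => [|w _]; last by rewrite mulr_ge0 ?u_ge0.
  move=> /allP/(_ z (mem_index_enum z))/=; rewrite mulf_eq0 => /orP[/eqP//|].
  rewrite mulf_eq0 invr_eq0 (gt_eqF (vmeasure_gt0 G y)) orbF => /eqP.
  by move/weight_eq0; rewrite edge_sym yz.
have zero y : u y t = 0.
  have /connectP[p xp ->] := edge_connected G x y.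
  elim: p x uxt0 xp => [//|z p IHp] x uxt0 /= /andP[xz zp].
  exact: IHp (step _ _ xz uxt0) zp.
have [y uy] := hu0_neq0.
have /u_gt0/(_ t tI') : 0 < u y 0 by rewrite hinit lt0r uy hu0_ge0.
by rewrite zero ltxx.
Qed.
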